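(* Let $0<p<1$ and let $\mu$ be the translation-invariant probability measure on labellings of the edges of $\mathbb{Z}^2$ by $\{0,1\}$ obtained from the square-by-square labelling procedure with parameter $p$ described in the context. Then $\mu$ does not percolate a.s.; that is, $\mu$-a.s. there is no infinite cluster of edges labelled $0$.
   Context: Edges are the nearest-neighbour edges of $\mathbb{Z}^2$, with labels in $\{0,1\}$. Put $q=1-p$. Labelling procedure in the first quadrant $[0,\infty)\times[0,\infty)$: label each edge of the nonnegative $x$-axis $0$ with probability $q$ and $1$ with probability $p$; label each edge of the nonnegative $y$-axis $0$ with probability $p$ and $1$ with probability $q$; all these labels are independent. Then label the unit squares of the strip $[0,\infty)\times[0,1]$ one after another from left to right, then those of the strip $[0,\infty)\times[1,2]$ from left to right, and so on. When a square is treated, its left and bottom edges already have labels $\ell$ and $b$; its right and top edges receive labels $r,t\in\{0,1\}$ such that the cocycle condition $b+r=\ell+t$ holds. If $b\neq\ell$ this forces $r=\ell$, $t=b$; if $b=\ell$ there are two possibilities, $r=t=0$ and $r=t=1$, and one of them is chosen with probability $1/2$ each, independently of everything else. The resulting law on labellings of the first quadrant is invariant under translation by $(1,0)$ and $(0,1)$, and by Kolmogorov consistency it extends to a unique translation-invariant probability measure $\mu$ on $\{0,1\}^E$, $E$ being the set of all edges of $\mathbb{Z}^2$, whose restriction to the edges of the first quadrant is this law. The cluster $C(z)$ of a vertex $z$ is the set of vertices that can be reached from $z$ by travelling over edges labelled $0$ only; percolation refers to the existence of an infinite such cluster. *)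

(* Defs.v *)
From mathcomp Require Import all_boot all_order all_algebra.
From mathcomp Require Import all_classical all_reals all_analysis.

Set Implicit Arguments.
Unset Strict Implicit.
Unset Printing Implicit Defensive.

Import Order.TTheory GRing.Theory Num.Theory.

Local Open Scope classical_set_scope.
Local Open Scope ring_scope.

(* Labels are booleans, [false] standing for 0 and [true] for 1. The space
   [E -> bool] carries the product sigma-algebra, generated by the coordinates. *)
Definition coordinate_events (E : Type) : set (set (E -> bool)) :=
  [set A | exists (e : E) (b : bool), A = [set w | w e = b]].

Definition labelling (E : Type) := g_sigma_algebraType (@coordinate_events E).

(* An edge is given by its left (resp. bottom) endpoint and its direction:
   [(x, horizontal)] joins [x] to [x + (1, 0)] and [(x, vertical)] joins [x]
   to [x + (0, 1)]. *)
Definition direction := bool.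
Definition horizontal : direction := false.
Definition vertical : direction := true.

Definition vertex := (int * int)%type.
Definition edge := (vertex * direction)%type.
Definition quadrant_edge := ((nat * nat) * direction)%type.

Definition edge_of_quadrant (e : quadrant_edge) : edge :=
  ((e.1.1%:Z, e.1.2%:Z), e.2).

Definition restrict_quadrant (w : labelling edge) : labelling quadrant_edge :=
  fun e => w (edge_of_quadrant e).

Definition translate (v : vertex) (w : labelling edge) : labelling edge :=
  fun e => w (e.1 + v, e.2).

(* The pair [(r, t)] of labels of the right and top edges of a square whose left
   and bottom edges have labels [l] and [b]; [c] is the coin of that square,
   which is only looked at when [b = l]. *)
Definition label_square (l b c : bool) : bool * bool :=
  if b != l then (l, b) else (c, c).

Lemma label_square_cocycle (l b c : bool) :
  let: (r, t) := label_square l b c in (b + r = l + t)%N.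
Proof. by case: l b c => [] [] []. Qed.

(* The squares of a strip, treated from left to right: [bot i], [l0] and
   [coin i] are the label of the bottom edge of the [i]-th square, the label of
   the left end of the strip and the coin of the [i]-th square. *)
Fixpoint strip_left (bot : nat -> bool) (l0 : bool) (coin : nat -> bool)
    (i : nat) : bool :=
  if i is i'.+1 then
    (label_square (strip_left bot l0 coin i') (bot i') (coin i')).1
  else l0.

Definition strip_top (bot : nat -> bool) (l0 : bool) (coin : nat -> bool)
    (i : nat) : bool :=
  (label_square (strip_left bot l0 coin i) (bot i) (coin i)).2.

(* [row_labels x y coin j i] is the label of the edge joining [(i, j)] to
   [(i + 1, j)]; [x i], [y j] are the labels of the [i]-th edge of the x-axis
   and of the [j]-th edge of the y-axis, [coin i j] is the coin of the square
   with lower left corner [(i, j)]. *)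
Fixpoint row_labels (x y : nat -> bool) (coin : nat -> nat -> bool) (j : nat) :
    nat -> bool :=
  if j is j'.+1 then
    strip_top (row_labels x y coin j') (y j') (coin^~ j')
  else x.

Definition label_quadrant (x y : nat -> bool) (coin : nat -> nat -> bool) :
    labelling quadrant_edge :=
  fun e => let: ((i, j), dir) := e in
  if dir == horizontal then row_labels x y coin j i
  else strip_left (row_labels x y coin j) (y j) (coin^~ j) i.

(* Indices of the random choices: x-axis edges, y-axis edges, squares. *)
Definition choice_index := (nat + nat + nat * nat)%type.
Definition on_xaxis (i : nat) : choice_index := inl (inl i).
Definition on_yaxis (j : nat) : choice_index := inl (inr j).
Definition on_square (i j : nat) : choice_index := inr (i, j).

Definition mutually_independent d (T : measurableType d) (R : realType)
    (P : probability T R) (I : eqType) d' (T' : measurableType d')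
    (X : I -> {RV P >-> T'}) : Prop :=
  forall (s : seq I) (B : I -> set T'), uniq s ->
    (forall i, measurable (B i)) ->
    P (\bigcap_(i in [set` s]) X i @^-1` B i) =
    (\prod_(i <- s) P (X i @^-1` B i))%E.

Definition procedure_choices d (T : measurableType d) (R : realType)
    (P : probability T R) (p : R) (X : choice_index -> {RV P >-> bool}) : Prop :=
  [/\ mutually_independent X,
      forall i, P (X (on_xaxis i) @^-1` [set true]) = p%:E,
      forall j, P (X (on_yaxis j) @^-1` [set true]) = (1 - p)%:E &
      forall i j, P (X (on_square i j) @^-1` [set true]) = (2^-1)%:E].

Definition procedure d (T : measurableType d) (R : realType)
    (P : probability T R) (X : choice_index -> {RV P >-> bool}) (t : T) :
    labelling quadrant_edge :=
  label_quadrant (fun i => X (on_xaxis i) t) (fun j => X (on_yaxis j) t)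
    (fun i j => X (on_square i j) t).

Definition translation_invariant (R : realType)
    (mu : probability (labelling edge) R) : Prop :=
  forall (v : vertex) (A : set (labelling edge)), measurable A ->
    mu (translate v @^-1` A) = mu A.

(* The first-quadrant marginal of [mu] is the law of the procedure. *)
Definition extends_procedure d (T : measurableType d) (R : realType)
    (P : probability T R) (X : choice_index -> {RV P >-> bool})
    (mu : probability (labelling edge) R) : Prop :=
  forall A : set (labelling quadrant_edge), measurable A ->
    mu (restrict_quadrant @^-1` A) = P (procedure X @^-1` A).

Definition zero_adj (w : labelling edge) : rel vertex := fun x y =>
  [|| (y == x + (1, 0)) && ~~ w (x, horizontal),
      (y == x + (0, 1)) && ~~ w (x, vertical),
      (x == y + (1, 0)) && ~~ w (y, horizontal) |
      (x == y + (0, 1)) && ~~ w (y, vertical)].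

Definition zero_cluster (w : labelling edge) (z : vertex) : set vertex :=
  [set x | exists2 s : seq vertex, path (zero_adj w) z s & x = last z s].

Definition percolates (w : labelling edge) : Prop :=
  exists z : vertex, infinite_set (zero_cluster w z).

(* Main.v *)
Require Import Defs.
From mathcomp Require Import all_boot all_order all_algebra.
From mathcomp Require Import ring lra zify.
From mathcomp Require Import all_classical all_reals all_analysis.
Import Order.TTheory GRing.Theory Num.Theory.
Import numFieldNormedType.Exports.
Local Open Scope classical_set_scope.
Local Open Scope ring_scope.

Set Implicit Arguments.
Unset Strict Implicit.
Unset Printing Implicit Defensive.

(** The level lines of the height function whose increments are the labels run
    from north-west to south-east. A square whose four labels are all 1 is
    touched by two consecutive level lines, and by monotonicity of the height
    it separates the north-west part of the level set between them from the
    south-east part. So it suffices to find such a square, at the right height,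
    on both sides of every vertex [z].

    To find one south-east of [z = (0, N)] in the quadrant, walk down from [z]
    to the first vertical edge labelled 1, then right to the first bottom edge
    labelled 1: there a level line turns down, and the coin of that square, if
    it is 1, makes the next level line touch it. Otherwise start again from the
    lower right end of the turn. The walk only reveals labels on a down-right
    path, which are independent of one another and of the coins above the path,
    so that [N] rows and [M] columns are exhausted with probability at most
    [(1 - q/2)^N + (1 - p/2)^M]. North-west of [z], exchange the two axes. *)

(** * Following a level line in the quadrant *)

Definition config := choice_index -> bool.

Definition hlabel (o : config) (i j : nat) : bool :=
  row_labels (fun i => o (on_xaxis i)) (fun j => o (on_yaxis j))
    (fun i j => o (on_square i j)) j i.

Definition vlabel (o : config) (i j : nat) : bool :=
  strip_left (fun i => hlabel o i j) (o (on_yaxis j))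
    (fun i => o (on_square i j)) i.

Lemma vlabelS (o : config) (i j : nat) :
  vlabel o i.+1 j =
  (label_square (vlabel o i j) (hlabel o i j) (o (on_square i j))).1.
Proof. by []. Qed.

Lemma vlabel0 (o : config) (j : nat) : vlabel o 0 j = o (on_yaxis j).
Proof. by []. Qed.

Lemma hlabelS (o : config) (i j : nat) :
  hlabel o i j.+1 =
  (label_square (vlabel o i j) (hlabel o i j) (o (on_square i j))).2.
Proof. by []. Qed.

Lemma label_cocycle (o : config) (i j : nat) :
  (hlabel o i j + vlabel o i.+1 j = vlabel o i j + hlabel o i j.+1)%N.
Proof.
rewrite vlabelS hlabelS.
by have := label_square_cocycle (vlabel o i j) (hlabel o i j) (o (on_square i j));
  case: (label_square _ _ _).
Qed.

(* When [b = l] the label [b] takes the place of the used coin, so that the step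
   becomes an involution of the triples [(b, l, c)] which preserves their law. *)
Definition square_step (j : nat) (o : config) : config :=
  let b := o (on_xaxis 0) in
  if b != o (on_yaxis j) then o else
  let c := o (on_square 0 j) in
  fun e => if (e == on_xaxis 0) || (e == on_yaxis j) then c
           else if e == on_square 0 j then b else o e.

(** Sweeps the first column upwards: [on_xaxis 0] carries the horizontal label at the height
    reached, and [on_yaxis j] becomes the label of the right edge of the square (0, j). *)
Fixpoint column_step (n : nat) (o : config) : config :=
  if n is n'.+1 then square_step n' (column_step n' o) else o.

Lemma column_stepE (n : nat) (o : config) :
  [/\ column_step n o (on_xaxis 0) = hlabel o 0 n,
      forall i, column_step n o (on_xaxis i.+1) = o (on_xaxis i.+1),
      forall j, column_step n o (on_yaxis j) =
        if (j < n)%N then vlabel o 1 j else o (on_yaxis j),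
      forall i j, column_step n o (on_square i.+1 j) = o (on_square i.+1 j) &
      forall j, (n <= j)%N ->
        column_step n o (on_square 0 j) = o (on_square 0 j)].
Proof.
elim: n => [|n [IHx IHxS IHy IHqS IHq]] //.
rewrite /= /square_step IHx IHy ltnn IHq //; split=> [|i|j|i j|j ltnj].
- by rewrite hlabelS vlabel0 /label_square; case: ifP => // _; rewrite IHx.
- by case: ifP => _; rewrite ?IHxS.
- have [->|jn] := eqVneq j n.
    rewrite ltnSn vlabelS vlabel0 /label_square.
    by case: ifP; rewrite ?IHy ?ltnn ?eqxx ?orbT.
  have -> : (j < n.+1)%N = (j < n)%N by rewrite ltnS leq_eqVlt (negbTE jn).
  case: (hlabel o 0 n != _); rewrite /= ?IHy //.
  by have -> : (on_yaxis j == on_yaxis n) = false by exact: negbTE.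
- by case: (hlabel o 0 n != _); rewrite /= IHqS.
- case: (hlabel o 0 n != _); first by rewrite IHq // ltnW.
  have -> : (on_square 0 j == on_square 0 n) = false by exact: gtn_eqF.
  by rewrite /= IHq // ltnW.
Qed.

Definition shift_index (e : choice_index) : choice_index :=
  match e with
  | inl (inl i) => on_xaxis i.+1
  | inl (inr j) => on_yaxis j
  | inr (i, j) => on_square i.+1 j
  end.

(** The quadrant without its first column: below height [n] the new y-axis is the line x = 1, while
    [on_yaxis j] with j >= n keeps its old value. *)
Definition next_column (n : nat) (o : config) : config :=
  column_step n o \o shift_index.

(** Row [n] separates the two bounds: horizontal labels at height [n] depend only on the rows below,
    but vertical ones start from [on_yaxis n], which is not yet updated. *)
Lemma next_column_labels (n : nat) (o : config) (i j : nat) :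
  ((j <= n)%N -> hlabel (next_column n o) i j = hlabel o i.+1 j) /\
  ((j < n)%N -> vlabel (next_column n o) i j = vlabel o i.+1 j).
Proof.
have [_ cxS cy cqS _] := column_stepE n o.
suff H j' :
    ((j' <= n)%N -> forall i, hlabel (next_column n o) i j' = hlabel o i.+1 j') /\
    ((j' < n)%N -> forall i, vlabel (next_column n o) i j' = vlabel o i.+1 j').
  by split=> ?; have [H1 H2] := H j; [apply: H1|apply: H2].
have vstep k : (k < n)%N ->
    (forall i, hlabel (next_column n o) i k = hlabel o i.+1 k) ->
    forall i, vlabel (next_column n o) i k = vlabel o i.+1 k.
  move=> kn IHh; elim=> [|i' IHi].
    by rewrite vlabel0 /next_column /= cy kn.
  by rewrite vlabelS IHi IHh [in RHS]vlabelS /next_column /= cqS.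
elim: j' => [|k [IHh IHv]].
  have H0 i' : hlabel (next_column n o) i' 0 = hlabel o i'.+1 0.
    by rewrite /hlabel /= /next_column /= cxS.
  by split=> // kn; apply: vstep.
have HS : (k.+1 <= n)%N ->
    forall i', hlabel (next_column n o) i' k.+1 = hlabel o i'.+1 k.+1.
  move=> kn i'; rewrite !hlabelS IHv // IHh; last exact: ltnW.
  by rewrite /next_column /= cqS.
split=> // kn; apply: vstep => //; apply: HS; exact: ltnW.
Qed.

(** Height relative to the origin, read along the path (0, 0), (i, 0), (i, j). *)
Definition qheight (l : labelling quadrant_edge) (i j : nat) : nat :=
  (\sum_(0 <= k < i) l ((k, 0), horizontal)
   + \sum_(0 <= k < j) l ((i, k), vertical))%N.

Definition labels_of (o : config) : labelling quadrant_edge :=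
  label_quadrant (fun i => o (on_xaxis i)) (fun j => o (on_yaxis j))
    (fun i j => o (on_square i j)).

Lemma labels_of_h (o : config) (i j : nat) :
  labels_of o ((i, j), horizontal) = hlabel o i j.
Proof. by []. Qed.

Lemma labels_of_v (o : config) (i j : nat) :
  labels_of o ((i, j), vertical) = vlabel o i j.
Proof. by []. Qed.

Lemma qheight_next_column (n : nat) (o : config) (i j : nat) : (j <= n)%N ->
  qheight (labels_of o) i.+1 j =
  (hlabel o 0 0 + qheight (labels_of (next_column n o)) i j)%N.
Proof.
move=> jn; rewrite /qheight big_nat_recl // addnA; congr (_ + _ + _)%N.
  by apply: eq_bigr => k _; rewrite !labels_of_h (next_column_labels n o k 0).1.
apply: eq_big_nat => k /andP[_ kj].
by rewrite !labels_of_v (next_column_labels n o i k).2 // (leq_trans kj).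
Qed.

Lemma qheight_col1 (o : config) (n : nat) :
  qheight (labels_of o) 1 n = (qheight (labels_of o) 0 n + hlabel o 0 n)%N.
Proof.
rewrite /qheight big_nat1 (big_geq (leqnn 0)) add0n labels_of_h.
elim: n => [|n IHn]; first by rewrite !big_geq // addn0.
rewrite !big_nat_recr // addnA IHn !labels_of_v -!addnA; congr addn.
exact: label_cocycle.
Qed.

Lemma qheight0S (o : config) (n : nat) :
  qheight (labels_of o) 0 n.+1 =
  (qheight (labels_of o) 0 n + o (on_yaxis n))%N.
Proof. by rewrite /qheight big_nat_recr //= addnA. Qed.

(* The two level lines through the square with lower left corner [(m, k)]
   touch in that square. *)
Definition touching (l : labelling quadrant_edge) (m k : nat) : bool :=
  [&& l ((m, k), horizontal), l ((m, k), vertical),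
      l ((m.+1, k), vertical) & l ((m, k.+1), horizontal)].

(** The corners (m + 1, k) and (m, k + 1) then have the same height as (0, n), so this square blocks
    the level set of (0, n). *)
Definition touch_below (n : nat) (l : labelling quadrant_edge) : Prop :=
  exists m k, [/\ (k < n)%N, touching l m k &
                  (qheight l m k).+1 = qheight l 0 n].

(* [fail_down] looks down from [(0, n)] for the first vertical edge labelled 1,
   and [fail_right m n] follows the level line through the edge from [(0, n)]
   to [(0, n + 1)] over at most [m] squares, until it turns down; both return
   [true] if no touching square is met before leaving [m] columns. *)
Fixpoint fail_down (fr : nat -> config -> bool) (n : nat) (o : config) : bool :=
  if n is n'.+1 then
    if o (on_yaxis n') then fr n' o else fail_down fr n' o
  else true.

Fixpoint fail_right (m n : nat) (o : config) : bool :=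
  if m is m'.+1 then
    if column_step n o (on_xaxis 0) then
      ~~ o (on_square 0 n) && fail_down (fail_right m') n (next_column n o)
    else fail_right m' n (next_column n o)
  else true.

Lemma touching_next_column (n : nat) (o : config) (m k : nat) : (k < n)%N ->
  touching (labels_of (next_column n o)) m k = touching (labels_of o) m.+1 k.
Proof.
move=> kn; rewrite /touching !labels_of_h !labels_of_v.
rewrite (next_column_labels n o m k).1 ?(ltnW kn) //.
rewrite (next_column_labels n o m k).2 // (next_column_labels n o m.+1 k).2 //.
by rewrite (next_column_labels n o m k.+1).1.
Qed.

Lemma touchingE (o : config) (m k : nat) :
  touching (labels_of o) m k =
  [&& hlabel o m k, vlabel o m k & o (on_square m k)].
Proof.
rewrite /touching !labels_of_h !labels_of_v vlabelS hlabelS.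
by case: (hlabel o m k); case: (vlabel o m k); case: (o _).
Qed.

(** The claim for [fail_right m] is taken as a hypothesis, so that it can be supplied by the
    induction on [m] in the next lemma. *)
Lemma fail_down_touch (m n : nat) (o : config) :
  (forall k (o : config), o (on_yaxis k) -> ~~ fail_right m k o ->
    exists i j, [/\ (j <= k)%N, touching (labels_of o) i j &
                    qheight (labels_of o) i j = qheight (labels_of o) 0 k]) ->
  ~~ fail_down (fail_right m) n o -> touch_below n (labels_of o).
Proof.
move=> right_touch; elim: n => [//|n IHn] /=.
case: ifP => yn.
  move=> /(right_touch _ _ yn)[i [j [jn tij hij]]].
  by exists i, j; rewrite qheight0S yn addn1 hij.
move=> /IHn[i [j [jn tij hij]]]; exists i, j.
by rewrite qheight0S yn addn0 hij ltnW.
Qed.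

Lemma fail_right_touch (m n : nat) (o : config) :
  o (on_yaxis n) -> ~~ fail_right m n o ->
  exists i j, [/\ (j <= n)%N, touching (labels_of o) i j &
                  qheight (labels_of o) i j = qheight (labels_of o) 0 n].
Proof.
elim: m n o => [//|m IHm] n o yn /=.
have [-> _ cy cqS cq] := column_stepE n o.
have hshift i j := @qheight_next_column n o i j.
have := qheight_col1 o n; rewrite hshift //.
case: ifPn => t0 h1n.
  rewrite negb_and negbK => /orP[cn|].
    by exists 0, n; rewrite touchingE t0 cn vlabel0 yn.
  (* The vertex (1, n), from which the walk goes down, is one higher than (0, n); this cancels the
     successor in [touch_below]. *)
  move=> /(fail_down_touch IHm)[i [j [jn tij hij]]].
  exists i.+1, j; rewrite -(@touching_next_column n) // hshift; last exact: ltnW.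
  by split=> //; [exact: ltnW|lia].
have yn1 : next_column n o (on_yaxis n) by rewrite /next_column /= cy ltnn.
move=> /(IHm _ _ yn1)[i [j [jn tij hij]]].
exists i.+1, j; rewrite hshift //; split=> //; last by move: h1n; lia.
(* In row [n] the y-axis of the next column is not updated, yet its label is right: with bottom
   label 0 and left label 1 the square passes the 1 on to its right edge. *)
move: jn; rewrite leq_eqVlt => /orP[/eqP jn|jn]; last first.
  by rewrite -(@touching_next_column n).
subst j; move: tij; rewrite !touchingE.
rewrite (next_column_labels n o i n).1 // [next_column _ _ _]/next_column /= cqS.
case/and3P=> -> vi ->; rewrite andbT /=.
suff -> : vlabel o i.+1 n = vlabel (next_column n o) i n by [].
elim: {vi hij} i => [|i IHi].
  by rewrite vlabelS !vlabel0 yn1 yn (negbTE t0).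
by rewrite vlabelS IHi [RHS]vlabelS (next_column_labels n o i n).1 // /next_column /= cqS.
Qed.

Lemma fail_touch (m n : nat) (o : config) :
  ~~ fail_down (fail_right m) n o -> touch_below n (labels_of o).
Proof. by apply: fail_down_touch => k o'; exact: fail_right_touch. Qed.

(** * Measurability of the walk *)

Section MeasurableBool.
Context d (T : measurableType d).
Implicit Types f g h : T -> bool.

Lemma measurable_predT : measurable [set t : T | true].
Proof.
rewrite (_ : [set t | _] = setT); first exact: measurableT.
by apply/seteqP; split.
Qed.

Lemma measurable_predC f :
  measurable [set t | f t] -> measurable [set t | ~~ f t].
Proof.
move=> mf; rewrite (_ : [set t | _] = ~` [set t | f t]); first exact: measurableC.
by apply/seteqP; split=> t /= /negP.
Qed.

Lemma measurable_predI f g : measurable [set t | f t] ->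
  measurable [set t | g t] -> measurable [set t | f t && g t].
Proof.
move=> mf mg; rewrite (_ : [set t | _] = [set t | f t] `&` [set t | g t]).
  exact: measurableI.
by apply/seteqP; split=> t /= => [/andP|[-> ->]].
Qed.

Lemma measurable_pred_if f g h : measurable [set t | f t] ->
  measurable [set t | g t] -> measurable [set t | h t] ->
  measurable [set t | if f t then g t else h t].
Proof.
move=> mf mg mh.
rewrite (_ : [set t | _] = [set t | f t && g t] `|` [set t | ~~ f t && h t]).
  by apply: measurableU; apply: measurable_predI => //; exact: measurable_predC.
by apply/seteqP; split=> t /=; case: (f t) => /=; [left|right|case|case].
Qed.

Lemma measurable_pred_eq f (b : bool) :
  measurable [set t | f t] -> measurable [set t | f t == b].
Proof.
case: b => mf; first by under eq_set do rewrite eqb_id.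
by under eq_set do rewrite eqbF_neg; exact: measurable_predC.
Qed.

End MeasurableBool.

Section Observable.
Context d (T : measurableType d).
Implicit Type Y : T -> config.

Definition observable Y := forall e, measurable [set t | Y t e].

Lemma observable_label_square (l b c : T -> bool) :
  measurable [set t | l t] -> measurable [set t | b t] ->
  measurable [set t | c t] ->
  measurable [set t | (label_square (l t) (b t) (c t)).1] /\
  measurable [set t | (label_square (l t) (b t) (c t)).2].
Proof.
move=> ml mb mc; rewrite /label_square.
have E (x y : T -> bool) : measurable [set t | x t] -> measurable [set t | y t] ->
    measurable [set t | if b t != l t then x t else y t].
  move=> mx my; apply: measurable_pred_if => //; apply: measurable_predC.
  rewrite (_ : [set t | _] = [set t | if l t then b t else ~~ b t]).
    by apply: measurable_pred_if => //; exact: measurable_predC.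
  by apply/seteqP; split=> t /=; case: (b t); case: (l t).
split; [under eq_set do rewrite (fun_if fst) /= |
        under eq_set do rewrite (fun_if snd) /=]; exact: E.
Qed.

Lemma observable_labels Y i j : observable Y ->
  measurable [set t | hlabel (Y t) i j] /\ measurable [set t | vlabel (Y t) i j].
Proof.
move=> mY.
have vstep k : (forall i, measurable [set t | hlabel (Y t) i k]) ->
    forall i, measurable [set t | vlabel (Y t) i k].
  move=> mh; elim=> [|i' IHi]; first exact: mY.
  under eq_set do rewrite vlabelS.
  exact: (observable_label_square IHi (mh i') (mY _)).1.
suff mh k : forall i, measurable [set t | hlabel (Y t) i k].
  by split; [exact: mh|apply: vstep; exact: mh].
elim: k => [|k IHk] i'; first exact: mY.
under eq_set do rewrite hlabelS.
by apply: (observable_label_square _ _ _).2; [exact: vstep|exact: IHk|exact: mY].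
Qed.

Lemma observable_square_step Y n : observable Y ->
  observable (square_step n \o Y).
Proof.
move=> mY e; rewrite /square_step.
rewrite (_ : [set t | _] = [set t |
    if (Y t (on_xaxis 0) != Y t (on_yaxis n)) then Y t e else
    if (e == on_xaxis 0) || (e == on_yaxis n) then Y t (on_square 0 n)
    else if e == on_square 0 n then Y t (on_xaxis 0) else Y t e]); last first.
  by apply: eq_set => t /=; case: ifP.
apply: measurable_pred_if => //.
  apply: measurable_predC.
  rewrite (_ : [set t | _] = [set t | if Y t (on_xaxis 0)
    then Y t (on_yaxis n) else ~~ Y t (on_yaxis n)]).
    by apply: measurable_pred_if => //; exact: measurable_predC.
  by apply/seteqP; split=> t /=; case: (Y t _); case: (Y t _).
by case: (_ || _); [|case: (e == _)]; exact: mY.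
Qed.

Lemma observable_column_step Y n : observable Y ->
  observable (column_step n \o Y).
Proof.
by move=> mY; elim: n => [//|n]; exact: (@observable_square_step (column_step n \o Y)).
Qed.

Lemma observable_next_column Y n : observable Y ->
  observable (next_column n \o Y).
Proof. by move=> mY e; exact: (observable_column_step n mY (shift_index e)). Qed.

Lemma measurable_fail_down (fr : nat -> config -> bool) Y n :
  (forall k Y, observable Y -> measurable [set t | fr k (Y t)]) ->
  observable Y -> measurable [set t | fail_down fr n (Y t)].
Proof.
move=> mfr mY; elim: n => [|n IHn] /=; first exact: measurable_predT.
by apply: measurable_pred_if => //; exact: mfr.
Qed.

Lemma measurable_fail_right Y m n : observable Y ->
  measurable [set t | fail_right m n (Y t)].
Proof.
elim: m n Y => [|m IHm] n Y mY /=; first exact: measurable_predT.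
have mZ := observable_next_column n mY.
apply: measurable_pred_if; first exact: (observable_column_step n mY).
  apply: measurable_predI; first exact: measurable_predC.
  apply: (@measurable_fail_down _ (next_column n \o Y)) => // k Y' mY'; exact: IHm.
exact: (IHm n (next_column n \o Y) mZ).
Qed.

End Observable.

(** * The probability that the walk fails *)

Lemma square_stepK (j : nat) (o : config) :
  square_step j (square_step j o) =1 o.
Proof.
move=> e; rewrite /square_step.
case: (boolP (o (on_xaxis 0) != o (on_yaxis j))) => [->//|/negbNE/eqP bl].
rewrite /= !eqxx /=.
case: eqP => [->//|_]; case: eqP => [->//|_] /=.
by case: eqP => [->|].
Qed.

Lemma square_step_out (j : nat) (o : config) e :
  e \notin [:: on_xaxis 0; on_yaxis j; on_square 0 j] ->
  square_step j o e = o e.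
Proof.
rewrite !inE !negb_or /square_step => /and3P[e1 e2 e3].
by case: ifP => //; rewrite (negbTE e1) (negbTE e2) (negbTE e3).
Qed.

Lemma eq_in_square_step (s : seq choice_index) (j : nat) (o o' : config) :
  {subset [:: on_xaxis 0; on_yaxis j; on_square 0 j] <= s} ->
  {in s, o =1 o'} -> {in s, square_step j o =1 square_step j o'}.
Proof.
move=> sub eqo e es; rewrite /square_step.
have eqK e' : e' \in [:: on_xaxis 0; on_yaxis j; on_square 0 j] -> o e' = o' e'.
  by move=> /sub; exact: eqo.
rewrite !eqK ?inE ?eqxx ?orbT //.
by case: ifP => _; rewrite eqo.
Qed.

(** Factor gained per row ([q] replaced by 1 - p) or per column (by p): a label 1 has probability
    [q], and then the coin is 1 with probability 1/2. *)
Definition rate (R : realType) (q : R) : R := 1 - q / 2.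

Lemma rate_ge0 (R : realType) (q : R) : 0 <= q -> q <= 1 -> 0 <= rate q.
Proof. by rewrite /rate => ? ?; lra. Qed.

(** One row of the descent, with x = a^n and y = v^m: a label 1 starts [fail_right], with bound x/2
    + y, and a label 0 continues with x + y. *)
Lemma down_step (R : realType) (p x y : R) :
  (1 - p) * (x / 2 + y) + p * (x + y) = rate (1 - p) * x + y.
Proof. by rewrite /rate; field. Qed.

(** One column: a label 1 followed by a coin 0 resumes the descent, a label 0 moves to the next
    column. The half before x pays for the coin that must fail before any further descent. *)
Lemma right_step (R : realType) (p x y : R) :
  p * ((1 - 2^-1) * (x + y)) + (1 - p) * (x / 2 + y) = x / 2 + rate p * y.
Proof. by rewrite /rate; field. Qed.

Section Laws.
Context (R : realType) (p : R) d (T : measurableType d) (P : probability T R).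
Implicit Types (Y : T -> config) (E : set T) (s : seq choice_index).
Implicit Types (D : pred choice_index) (c : config).

Definition pr (A : set T) : R := fine (P A).

Lemma pr_le A B : measurable A -> measurable B -> A `<=` B -> pr A <= pr B.
Proof.
move=> mA mB AB; apply: fine_le; rewrite ?fin_num_measure //.
by apply: le_measure => //; rewrite inE.
Qed.

Lemma pr_ge0 A : 0 <= pr A. Proof. exact: fine_ge0. Qed.

Lemma pr_split A (f : T -> bool) : measurable A -> measurable [set t | f t] ->
  pr A = pr (A `&` [set t | f t == true]) + pr (A `&` [set t | f t == false]).
Proof.
move=> mA mf.
have mb b : measurable (A `&` [set t | f t == b]).
  by apply: measurableI => //; exact: measurable_pred_eq.
rewrite /pr -fineD ?fin_num_measure // -measureU //; last first.
  by apply/seteqP; split=> t //= [[_ /eqP->] [_]].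
congr (fine (P _)); apply/seteqP; split=> t /=; last by case=> -[].
by case: (f t) => At; [left|right].
Qed.

Definition weight (e : choice_index) (b : bool) : R :=
  let a := match e with
    | inl (inl _) => p | inl (inr _) => 1 - p | inr _ => 2^-1
    end in
  if b then a else 1 - a.

Definition agrees s Y c : set T := [set t | all (fun e => Y t e == c e) s].

(** Unnormalised conditioning on [E]: no division occurs, and [E] may be null. *)
Definition list_law s Y E := forall c,
  pr (E `&` agrees s Y c) = pr E * \prod_(e <- s) weight e (c e).

(* The choices of [Y] with index in [D] are independent, and independent of [E]. *)
Definition has_law D Y E := forall s, uniq s -> all D s -> list_law s Y E.

Definition update c e (b : bool) : config := fun e' => if e' == e then b else c e'.

Lemma agrees_cons_update s Y c e b : e \notin s ->
  agrees (e :: s) Y (update c e b) = [set t | Y t e == b] `&` agrees s Y c.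
Proof.
move=> es; apply/seteqP; rewrite /agrees /update.
have H t : all (fun e' => Y t e' == (if e' == e then b else c e')) s =
    all (fun e' => Y t e' == c e') s.
  apply: eq_in_all => e' e's; have [ee|//] := eqVneq e' e.
  by rewrite -ee e's in es.
by split=> t /=; rewrite eqxx H; [move/andP|case=> -> ->].
Qed.

Lemma prod_cons_update s c e b : e \notin s ->
  \prod_(e' <- e :: s) weight e' (update c e b e') =
  weight e b * \prod_(e' <- s) weight e' (c e').
Proof.
move=> es; rewrite big_cons {1}/update eqxx; congr (_ * _).
rewrite [LHS]big_seq [RHS]big_seq; apply: eq_bigr => e' e's.
by rewrite /update; have [ee|//] := eqVneq e' e; rewrite -ee e's in es.
Qed.

Lemma measurable_agrees s Y c : observable Y -> measurable (agrees s Y c).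
Proof.
move=> mY; rewrite /agrees; elim: s => [|e s IHs] /=.
  exact: measurable_predT.
by apply: measurable_predI => //; exact: measurable_pred_eq.
Qed.

Lemma weightD e : weight e true + weight e false = 1.
Proof. by rewrite /weight addrC subrK. Qed.

Lemma list_law_behead s Y E e : observable Y -> measurable E -> e \notin s ->
  list_law (e :: s) Y E -> list_law s Y E.
Proof.
move=> mY mE es law c.
rewrite (@pr_split _ (fun t => Y t e)) //; last first.
  by apply: measurableI => //; exact: measurable_agrees.
have H b : pr (E `&` agrees s Y c `&` [set t | Y t e == b]) =
    pr E * (weight e b * \prod_(e' <- s) weight e' (c e')).
  by rewrite -prod_cons_update // -law agrees_cons_update // setIAC setIA.
by rewrite !H -mulrDr -mulrDl weightD mul1r.
Qed.

Lemma list_law_perm s s' Y E : perm_eq s s' -> list_law s Y E -> list_law s' Y E.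
Proof.
move=> ss' law c; rewrite -(perm_big _ ss') -law; congr (pr (_ `&` _)).
by apply: eq_set => t; rewrite (perm_all _ ss').
Qed.

(** The surplus indices are moved to the front and summed out one at a time, so a law may be checked
    on a convenient longer list. *)
Lemma list_law_sub s s' Y E : observable Y -> measurable E ->
  uniq s -> uniq s' -> {subset s <= s'} -> list_law s' Y E -> list_law s Y E.
Proof.
move=> mY mE us us' ss'.
have ps' : perm_eq s' ([seq e <- s' | e \notin s] ++ s).
  apply: uniq_perm => //.
    rewrite cat_uniq filter_uniq // us andbT; apply/hasPn => e es.
    by rewrite mem_filter es.
  move=> e; rewrite mem_cat mem_filter; case: (boolP (e \in s)) => /=.
    by move=> /ss' ->.
  by rewrite orbF.
move/(list_law_perm ps').
have := perm_uniq ps'; rewrite us' => /esym {ps'}.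
elim: [seq _ <- _ | _] => [//|e r IHr] /= /andP[er ur] law.
by apply: IHr => //; apply: list_law_behead law.
Qed.

Lemma has_law_sub D D' Y E : {subset D' <= D} -> has_law D Y E -> has_law D' Y E.
Proof.
move=> DD' law s us /allP sD'; apply: law => //; apply/allP => e /sD'; exact: DD'.
Qed.

Lemma has_law_shift D D' (h : choice_index -> choice_index) Y E :
  injective h -> (forall e, weight (h e) = weight e) ->
  (forall e, D' e -> D (h e)) ->
  has_law D Y E -> has_law D' (fun t => Y t \o h) E.
Proof.
move=> hI hw hD law s us sD' c.
(* The default [on_xaxis 0] is taken only off the image of [h], where [g] is never evaluated
   below. *)
have [g hK] : exists g, cancel h g.
  pose g e := xget (on_xaxis 0) [set e' | h e' = e].
  exists g => e; apply: hI.
  by apply: (@xgetPex _ (on_xaxis 0) [set e' | h e' = h e]); exists e.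
have -> : agrees s (fun t => Y t \o h) c = agrees (map h s) Y (c \o g).
  apply: eq_set => t; rewrite all_map; congr is_true.
  by apply: eq_all => e /=; rewrite hK.
rewrite law ?map_inj_uniq //; last by rewrite all_map; apply: sub_all sD' => e; exact: hD.
by rewrite big_map; congr (_ * _); apply: eq_bigr => e _; rewrite /= hK hw.
Qed.

Lemma has_law_pr D Y E e b : has_law D Y E -> D e ->
  pr (E `&` [set t | Y t e == b]) = pr E * weight e b.
Proof.
move=> law De; have := law [:: e] isT _ (fun=> b).
rewrite /= De big_seq1 => <- //; congr (pr (_ `&` _)).
by apply: eq_set => t /=; rewrite andbT.
Qed.

(** Revealing a label moves it from the fresh choices into the event; each step of the walk is
    analysed this way. *)
Lemma has_law_cond D Y E e b : has_law D Y E -> D e ->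
  has_law (predD1 D e) Y (E `&` [set t | Y t e == b]).
Proof.
move=> law De s us sD c.
have es : e \notin s by apply/negP => /(allP sD); rewrite /= eqxx.
rewrite (has_law_pr _ law) // -setIA -agrees_cons_update // law /=.
- by rewrite prod_cons_update // mulrA.
- by rewrite es.
- by rewrite De; apply: sub_all sD => e' /andP[].
Qed.

(** The values b = l = 1 and b = l = 0 both have weight p(1 - p), since the axes have complementary
    parameters, and the coin is fair; exchanging the common value with the coin is therefore
    harmless. *)
Lemma weight_square_step j c :
  let K := [:: on_xaxis 0; on_yaxis j; on_square 0 j] in
  \prod_(e <- K) weight e (square_step j c e) = \prod_(e <- K) weight e (c e).
Proof.
rewrite /= !big_cons !big_nil /square_step.
case: ifPn => // /negbNE/eqP bl; rewrite /= !eqxx /= -bl.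
by case: (c _); case: (c _) => /=; field.
Qed.

(** Change of variables along an involution: the stepped configuration agrees with [c] exactly when
    [Y] agrees with the stepped [c], which has the same weight. *)
Lemma has_law_square_step D Y E j : observable Y -> measurable E ->
  {subset [:: on_xaxis 0; on_yaxis j; on_square 0 j] <= D} ->
  has_law D Y E -> has_law D (square_step j \o Y) E.
Proof.
move=> mY mE; set K := [:: _; _; _] => KD law s us sD.
have mZ : observable (square_step j \o Y) by exact: observable_square_step.
have uK : uniq K by [].
pose r := [seq e <- s | e \notin K].
have uKr : uniq (K ++ r).
  rewrite cat_uniq filter_uniq // uK andbT; apply/hasPn => e.
  by rewrite mem_filter => /andP[].
have sKr : {subset s <= K ++ r}.
  by move=> e es; rewrite mem_cat mem_filter es andbT orbN.
(* The list must contain all three indices of the square for the step to act on it. *)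
apply: (list_law_sub mZ mE us uKr sKr) => c.
have -> : agrees (K ++ r) (square_step j \o Y) c =
    agrees (K ++ r) Y (square_step j c).
  have sub : {subset K <= K ++ r} by move=> e; rewrite mem_cat => ->.
  apply: eq_set => t; apply/propext; split=> /allP H; apply/allP => e es.
    have Ho : {in K ++ r, square_step j (Y t) =1 c} by move=> e' /H/eqP.
    by apply/eqP; rewrite -(square_stepK j (Y t)); exact: (eq_in_square_step sub Ho).
  have Ho : {in K ++ r, Y t =1 square_step j c} by move=> e' /H/eqP.
  by apply/eqP; rewrite -[RHS](square_stepK j c); exact: (eq_in_square_step sub Ho).
rewrite law //; last first.
  rewrite all_cat; apply/andP; split; first exact/allP.
  by apply/allP => e; rewrite mem_filter => /andP[_ /(allP sD)].
rewrite !big_cat /= weight_square_step; congr (_ * (_ * _)).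
rewrite [LHS]big_seq [RHS]big_seq; apply: eq_bigr => e.
by rewrite mem_filter => /andP[eK _]; rewrite square_step_out.
Qed.

Lemma has_law_column_step D Y E n : observable Y -> measurable E ->
  (forall j, (j < n)%N ->
    {subset [:: on_xaxis 0; on_yaxis j; on_square 0 j] <= D}) ->
  has_law D Y E -> has_law D (column_step n \o Y) E.
Proof.
move=> mY mE; elim: n => [//|n IHn] KD law.
apply: (@has_law_square_step D (column_step n \o Y)) => //.
- exact: observable_column_step.
- exact: KD.
- by apply: IHn => // j jn; apply: KD; exact: ltnW.
Qed.

(** The choices that must still be fresh when the walk stands at (0, n) and looks down. *)
Definition below n : pred choice_index := fun e =>
  match e with
  | inl (inl _) => true | inl (inr j) => (j < n)%N | inr (_, j) => (j < n)%N
  end.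

(** Here the walk moves right in row [n]: [on_yaxis n] has been revealed, but the coins of that row
    are still fresh. *)
Definition below_row n : pred choice_index := fun e =>
  match e with
  | inl (inl _) => true | inl (inr j) => (j < n)%N | inr (_, j) => (j <= n)%N
  end.

Hypotheses (p_ge0 : 0 <= p) (p_le1 : p <= 1).

Let a : R := rate (1 - p).
Let v : R := rate p.

Lemma fail_down_le m n Y E :
  (forall k Y E, observable Y -> measurable E -> has_law (below_row k) Y E ->
    pr (E `&` [set t | fail_right m k (Y t)]) <= pr E * (a ^+ k / 2 + v ^+ m)) ->
  observable Y -> measurable E -> has_law (below n) Y E ->
  pr (E `&` [set t | fail_down (fail_right m) n (Y t)]) <=
  pr E * (a ^+ n + v ^+ m).
Proof.
move=> right_le mY.
have v_ge0 : 0 <= v by exact: rate_ge0.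
elim: n E => [|n IHn] E mE law.
  apply: (@le_trans _ _ (pr E)); last first.
    by rewrite ler_peMr ?pr_ge0 // expr0 lerDl exprn_ge0.
  by rewrite /=; apply: pr_le => //; apply: measurableI => //; exact: measurable_predT.
have mfd k : measurable [set t | fail_down (fail_right m) k (Y t)].
  by apply: measurable_fail_down => // k' Y' mY'; exact: measurable_fail_right.
have mYb b : measurable [set t | Y t (on_yaxis n) == b] by exact: measurable_pred_eq.
rewrite (@pr_split _ (fun t => Y t (on_yaxis n))) //; last exact: measurableI.
have dn : below n.+1 (on_yaxis n) by rewrite /= ltnSn.
have prY b : pr (E `&` [set t | Y t (on_yaxis n) == b]) =
    pr E * weight (on_yaxis n) b by exact: has_law_pr law dn.
rewrite (_ : _ `&` [set t | _ == true] = E `&` [set t | Y t (on_yaxis n) == true]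
    `&` [set t | fail_right m n (Y t)]); last first.
  by apply/seteqP; split=> t /=; case: (Y t (on_yaxis n)) => -[[? ?] ?].
rewrite (_ : _ `&` [set t | _ == false] = E `&` [set t | Y t (on_yaxis n) == false]
    `&` [set t | fail_down (fail_right m) n (Y t)]); last first.
  by apply/seteqP; split=> t /=; case: (Y t (on_yaxis n)) => -[[? ?] ?].
have law_cond b := has_law_cond b law dn.
have le1 : pr (E `&` [set t | Y t (on_yaxis n) == true]
    `&` [set t | fail_right m n (Y t)]) <=
    pr E * (1 - p) * (a ^+ n / 2 + v ^+ m).
  rewrite -[pr E * (1 - p)](prY true); apply: right_le => //; first exact: measurableI.
  apply: has_law_sub (law_cond true) => -[[//|j]|[i j]] //.
  by rewrite /in_mem /= => jn; rewrite ltnS ltnW // andbT -[_ == _]/(j == n) ltn_eqF.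
have le0 : pr (E `&` [set t | Y t (on_yaxis n) == false]
    `&` [set t | fail_down (fail_right m) n (Y t)]) <=
    pr E * p * (a ^+ n + v ^+ m).
  have -> : pr E * p = pr E * weight (on_yaxis n) false.
    by rewrite /weight /= opprB addrCA subrr addr0.
  rewrite -prY; apply: IHn; first exact: measurableI.
  apply: has_law_sub (law_cond false) => -[[//|j]|[i j]] //.
    by rewrite /in_mem /= => jn; rewrite ltnS ltnW // andbT -[_ == _]/(j == n) ltn_eqF.
  by rewrite /in_mem /= => jn; exact: ltnW.
apply: le_trans (lerD le1 le0) _; rewrite -!mulrA -mulrDr ler_wpM2l ?pr_ge0 //.
by rewrite exprS down_step.
Qed.

(** The sweep of a column preserves the law, so the bottom label met at height [n] is as fresh as an
    x-axis label. Once it and, if it is 1, the coin of (0, n) are revealed, the next column again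
    has the law that the induction requires. *)
Lemma fail_right_le m n Y E : observable Y -> measurable E ->
  has_law (below_row n) Y E ->
  pr (E `&` [set t | fail_right m n (Y t)]) <= pr E * (a ^+ n / 2 + v ^+ m).
Proof.
have v_ge0 : 0 <= v by exact: rate_ge0.
have a_ge0 : 0 <= a by apply: rate_ge0; rewrite ?subr_ge0 // gerBl.
elim: m n Y E => [|m IHm] n Y E mY mE law.
  apply: (@le_trans _ _ (pr E)); last first.
    by rewrite ler_peMr ?pr_ge0 // expr0 lerDr divr_ge0 ?exprn_ge0.
  by rewrite /=; apply: pr_le => //; apply: measurableI => //; exact: measurable_predT.
set Z := column_step n \o Y.
have mZ : observable Z by exact: observable_column_step.
have lawZ : has_law (below_row n) Z E.
  apply: has_law_column_step => // j jn e; rewrite !inE => /or3P[]/eqP-> //.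
  by rewrite /in_mem /= ltnW.
have mfr k : measurable [set t | fail_right k n (Y t)] by exact: measurable_fail_right.
have mZb b e : measurable [set t | Z t e == b] by exact: measurable_pred_eq.
have mN : observable (next_column n \o Y) by exact: observable_next_column.
have lawx b := @has_law_cond _ _ _ (on_xaxis 0) b lawZ isT.
have sI : injective shift_index.
  by move=> [[i|j]|[i j]] [[i'|j']|[i' j']] // [] // -> // ->.
have sw e : weight (shift_index e) = weight e by case: e => [[]|[]].
have prx b := @has_law_pr _ _ _ (on_xaxis 0) b lawZ isT.
have dq : predD1 (below_row n) (on_xaxis 0) (on_square 0 n) by rewrite /= leqnn.
have prq := has_law_pr false (lawx true) dq.
have lawq := has_law_cond false (lawx true) dq.
have cq t : Z t (on_square 0 n) = Y t (on_square 0 n).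
  by have [_ _ _ _ H] := column_stepE n (Y t); exact: H.
rewrite (@pr_split _ (fun t => Z t (on_xaxis 0))) //; last exact: measurableI.
rewrite (_ : _ `&` [set t | _ == false] = E `&` [set t | Z t (on_xaxis 0) == false]
    `&` [set t | fail_right m n ((next_column n \o Y) t)]); last first.
  apply/seteqP; split=> t /=; rewrite -[column_step n (Y t)]/(Z t).
    by move=> [[Et +] /eqP Zx]; rewrite Zx.
  by move=> [[Et /eqP Zx] ?]; rewrite Zx.
rewrite (_ : _ `&` [set t | _ == true] = E `&` [set t | Z t (on_xaxis 0) == true]
    `&` [set t | Z t (on_square 0 n) == false]
    `&` [set t | fail_down (fail_right m) n ((next_column n \o Y) t)]); last first.
  apply/seteqP; split=> t /=; rewrite cq -[column_step n (Y t)]/(Z t).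
    by move=> [[Et +] /eqP Zx]; rewrite Zx => /andP[/negbTE-> ?].
  by move=> [[[Et /eqP Zx] /eqP ->] ?]; rewrite Zx.
have le1 := @fail_down_le m n (next_column n \o Y)
  (E `&` [set t | Z t (on_xaxis 0) == true] `&` [set t | Z t (on_square 0 n) == false])
  IHm mN.
have le0 := IHm n (next_column n \o Y) (E `&` [set t | Z t (on_xaxis 0) == false]) mN.
apply: le_trans (lerD (le1 _ _) (le0 _ _)) _.
- by do 2!apply: measurableI => //.
- apply: has_law_shift lawq => // -[[i|j]|[i j]] //= jn.
  by rewrite ltnW.
- exact: measurableI.
- by apply: has_law_shift (lawx false) => // -[[i|j]|[i j]].
rewrite prq !prx /weight /= -!mulrA -mulrDr ler_wpM2l ?pr_ge0 //.
by rewrite exprS right_step.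
Qed.

Lemma not_touch_below_le m n Y : observable Y -> has_law predT Y setT ->
  measurable [set t | touch_below n (labels_of (Y t))] ->
  pr [set t | ~ touch_below n (labels_of (Y t))] <= a ^+ n + v ^+ m.
Proof.
move=> mY law mt.
apply: (@le_trans _ _ (pr [set t | fail_down (fail_right m) n (Y t)])).
  apply: pr_le.
  - exact: measurableC.
  - by apply: measurable_fail_down => // k' Y' mY'; exact: measurable_fail_right.
  - by move=> t /= nt; apply/negP => /negP /fail_touch.
rewrite -[[set t | _]]setTI; apply: le_trans (fail_down_le _ _ _ _) _ => //.
- by move=> k Y' E; exact: fail_right_le.
- exact: has_law_sub law.
- by rewrite /pr probability_setT mul1r.
Qed.

End Laws.

(** * Heights and touching squares in the plane *)

(** The discrete primitive of [f] vanishing at 0; [Negz n] stands for -(n + 1), hence the bound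
    [n.+1]. *)
Definition potential (f : int -> int) (x : int) : int :=
  match x with
  | Posz n => \sum_(0 <= k < n) f k
  | Negz n => - \sum_(0 <= k < n.+1) f (Negz k)
  end.

Lemma potential_step (f : int -> int) (x : int) :
  potential f (x + 1) = potential f x + f x.
Proof.
case: x => [n|[|n]].
- by rewrite -PoszD addn1 /= big_nat_recr.
- by rewrite /= big_nat1 big_geq // addNr.
- have -> : Negz n.+1 + 1 = Negz n by lia.
  by rewrite /= [in RHS]big_nat_recr //= opprD addrNK.
Qed.

Lemma int_shift_const (f : int -> int) : (forall x : int, f (x + 1) = f x) ->
  forall x : int, f x = f 0.
Proof.
move=> fS [n|n].
  by elim: n => [//|n IHn]; rewrite -addn1 PoszD fS.
elim: n => [|n IHn]; first by rewrite -(fS (Negz 0)).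
by rewrite -IHn -(fS (Negz n.+1)); congr f; lia.
Qed.

Lemma vertex_right (x y : int) : ((x, y) : vertex) + (1, 0) = (x + 1, y).
Proof. by rewrite -[LHS]/(x + 1, y + 0) addr0. Qed.

Lemma vertex_up (x y : int) : ((x, y) : vertex) + (0, 1) = (x, y + 1).
Proof. by rewrite -[LHS]/(x + 0, y + 1) addr0. Qed.

Definition right_label (w : labelling edge) (x y : int) : bool :=
  w ((x, y), horizontal).

Definition up_label (w : labelling edge) (x y : int) : bool :=
  w ((x, y), vertical).

Definition cocycle (w : labelling edge) : Prop := forall x y : int,
  (right_label w x y + up_label w (x + 1)%R y =
   up_label w x y + right_label w x (y + 1)%R)%N.

Section Height.
Variables (w : labelling edge).
Hypothesis w_cocycle : cocycle w.

Definition height (x y : int) : int :=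
  potential (fun i => (right_label w i 0)%:Z) x +
  potential (fun j => (up_label w x j)%:Z) y.

Lemma height_up (x y : int) :
  height x (y + 1) = height x y + (up_label w x y)%:Z.
Proof. by rewrite /height potential_step addrA. Qed.

(** The defect [f] does not depend on y, by the cocycle condition, and vanishes at y = 0 by
    construction. *)
Lemma height_right (x y : int) :
  height (x + 1) y = height x y + (right_label w x y)%:Z.
Proof.
pose f (y : int) : int := height (x + 1) y - height x y - (right_label w x y)%:Z.
have pot0 g : potential g 0 = 0 by rewrite [LHS](big_geq (leqnn 0)).
have f0 : f 0 = 0 by rewrite /f /height potential_step !pot0 !addr0 addrAC addrK subrr.
suff /(_ y) : forall y : int, f y = f 0 by rewrite f0 /f; lia.
apply: int_shift_const => y1.
by have := w_cocycle x y1; rewrite /f !height_up; lia.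
Qed.

Lemma le_height (x y x' y' : int) : x <= x' -> y <= y' ->
  height x y <= height x' y'.
Proof.
move=> xx' yy'; apply: (@le_trans _ _ (height x' y)).
  have -> : x' = x + `|x' - x|%N by lia.
  elim: `|_|%N => [|n IHn]; first by rewrite addr0.
  by apply: le_trans IHn _; rewrite -addn1 PoszD addrA height_right lerDl.
have -> : y' = y + `|y' - y|%N by lia.
elim: `|_|%N => [|n IHn]; first by rewrite addr0.
by apply: le_trans IHn _; rewrite -addn1 PoszD addrA height_up lerDl.
Qed.

Lemma zero_adj_height (u v : vertex) : zero_adj w u v ->
  height v.1 v.2 = height u.1 u.2.
Proof.
case: u v => [x y] [x' y'].
rewrite /zero_adj !vertex_right !vertex_up -!/(right_label _ _ _) -!/(up_label _ _ _).
case/or4P => /andP[/eqP[-> ->] /negbTE wF] /=;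
  by rewrite ?height_up ?height_right // wF addr0.
Qed.

(* [u] is the lower left corner of a square in which two level lines touch;
   its other two corners have the intermediate height [h]. *)
Definition pinch (h : int) (u : vertex) : Prop :=
  height u.1 u.2 < h /\ h < height (u.1 + 1) (u.2 + 1).

(** The cluster keeps the height of [z]. By monotonicity no vertex of that height lies weakly
    south-west of [u] or weakly north-east of u + (1, 1), and likewise for [u']; a step out of the
    box through any of its sides would enter one of these four regions. *)
Lemma zero_cluster_pinched (z u u' : vertex) :
  pinch (height z.1 z.2) u -> pinch (height z.1 z.2) u' ->
  z.1 <= u.1 -> u.2 < z.2 -> u'.1 < z.1 -> z.2 <= u'.2 ->
  zero_cluster w z `<=`
    [set x | [/\ u'.1 < x.1, x.1 <= u.1, u.2 < x.2 & x.2 <= u'.2]].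
Proof.
move=> [uz zu] [u'z zu'] z1 z2 z3 z4 x [s + ->].
pose inside (v : vertex) :=
  [/\ u'.1 < v.1, v.1 <= u.1, u.2 < v.2 & v.2 <= u'.2].
have step (a b : vertex) : height a.1 a.2 = height z.1 z.2 -> inside a ->
    zero_adj w a b -> inside b.
  move=> ha [a1 a2 a3 a4] ab.
  have hb := zero_adj_height ab; rewrite ha in hb.
  have Hu := @le_height b.1 b.2 u.1 u.2.
  have Hu1 := @le_height (u.1 + 1) (u.2 + 1) b.1 b.2.
  have Hu' := @le_height b.1 b.2 u'.1 u'.2.
  have Hu'1 := @le_height (u'.1 + 1) (u'.2 + 1) b.1 b.2.
  case: a b ab {ha} a1 a2 a3 a4 hb Hu Hu1 Hu' Hu'1 => [x1 y1] [x2 y2] /=.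
  rewrite /zero_adj !vertex_right !vertex_up.
  by case/or4P => /andP[/eqP[-> ->] _] /= *; split=> /=; lia.
suff H a : height a.1 a.2 = height z.1 z.2 -> inside a ->
    path (zero_adj w) a s -> inside (last a s) by apply: H.
elim: s a => [//|b s IHs] a ha ina /= /andP[ab]; apply: IHs; last exact: step ab.
by rewrite (zero_adj_height ab).
Qed.

End Height.

Lemma finite_box (a b c d : int) : finite_set
  [set x : vertex | [/\ a < x.1, x.1 <= b, c < x.2 & x.2 <= d]].
Proof.
apply: (@sub_finite_set _ _ ((fun ij : nat * nat => (a + ij.1%:Z, c + ij.2%:Z)) @`
    (`I_(`|b - a|.+1) `*` `I_(`|d - c|.+1)))).
  move=> [x y] /= [ax xb cy yd].
  exists (`|x - a|%N, `|y - c|%N) => /=; first by split; lia.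
  by congr (_, _); lia.
by apply: finite_image; apply: finite_setX; exact: finite_II.
Qed.

(** Links the planar [height], seen from the corner of a translated quadrant, to [qheight]. *)
Lemma qheight_unique (g : nat -> nat -> int) (l : labelling quadrant_edge) :
  (forall i, g i.+1 0%N = g i 0%N + (l ((i, 0%N), horizontal))%:Z) ->
  (forall i j, g i j.+1 = g i j + (l ((i, j), vertical))%:Z) ->
  forall i j, g i j = g 0%N 0%N + qheight l i j.
Proof.
move=> gx gy i; rewrite /qheight; elim=> [|j IHj].
  rewrite [in RHS](big_geq (leqnn 0)) addn0.
  elim: i => [|i IHi]; first by rewrite big_geq // addr0.
  by rewrite big_nat_recr //= gx IHi PoszD addrA.
by rewrite [in RHS]big_nat_recr //= gy IHj -addrA -PoszD addnA.
Qed.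

Definition reflect_labels (l : labelling quadrant_edge) : labelling quadrant_edge :=
  fun e => l ((e.1.2, e.1.1), ~~ e.2).

Definition quadrant_at (v : vertex) (w : labelling edge) :
    labelling quadrant_edge :=
  restrict_quadrant (translate v w).

Lemma quadrant_atE (w : labelling edge) (x y : int) (i j : nat) (b : direction) :
  quadrant_at (x, y) w ((i, j), b) =
  if b then up_label w (x + i%:Z) (y + j%:Z)
  else right_label w (x + i%:Z) (y + j%:Z).
Proof. by rewrite /up_label /right_label (addrC x) (addrC y); case: b. Qed.

(** In the first quadrant [z] is the vertex (0, n); in the second it is (n, 0), which the reflection
    turns into (0, n). *)
Definition unpinched (n : nat) (z : vertex) (w : labelling edge) : Prop :=
  ~ touch_below n (quadrant_at (z - (0, n%:Z)) w) \/
  ~ touch_below n (reflect_labels (quadrant_at (z - (n%:Z, 0)) w)).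

Lemma finite_cluster (w : labelling edge) (z : vertex) (n : nat) :
  cocycle w -> ~ unpinched n z w -> finite_set (zero_cluster w z).
Proof.
move=> wC /not_orP[/contrapT[m [k [kn tmk hmk]]] /contrapT[m' [k' [kn' tmk' hmk']]]].
case: z hmk tmk hmk' tmk' => x y hmk tmk hmk' tmk'.
set l := quadrant_at _ _ in hmk tmk; set l' := quadrant_at _ _ in hmk' tmk'.
have lE i j b : l ((i, j), b) = if b then up_label w (x + i%:Z) (y - n%:Z + j%:Z)
    else right_label w (x + i%:Z) (y - n%:Z + j%:Z).
  by rewrite -[X in right_label _ (X + _)]subr0 -[X in up_label _ (X + _)]subr0
    -quadrant_atE.
have l'E i j b : l' ((i, j), b) =
    if b then up_label w (x - n%:Z + i%:Z) (y + j%:Z)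
    else right_label w (x - n%:Z + i%:Z) (y + j%:Z).
  by rewrite -[X in right_label _ _ (X + _)]subr0 -[X in up_label _ _ (X + _)]subr0
    -quadrant_atE.
have hl (i j : nat) : height w (x + i%:Z) (y - n%:Z + j%:Z) =
    height w x (y - n%:Z) + qheight l i j.
  pose g (i j : nat) := height w (x + i%:Z) (y - n%:Z + j%:Z).
  have -> : height w x (y - n%:Z) = g 0%N 0%N by rewrite /g !addr0.
  apply: (@qheight_unique g) => [i'|i' j']; rewrite /g lE /=.
    by rewrite -addn1 PoszD addrA height_right.
  by rewrite -addn1 PoszD [in LHS]addrA height_up.
have hl' (i j : nat) : height w (x - n%:Z + j%:Z) (y + i%:Z) =
    height w (x - n%:Z) y + qheight (reflect_labels l') i j.
  pose g (i j : nat) := height w (x - n%:Z + j%:Z) (y + i%:Z).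
  have -> : height w (x - n%:Z) y = g 0%N 0%N by rewrite /g !addr0.
  apply: (@qheight_unique g) => [i'|i' j']; rewrite /g /reflect_labels /= l'E /=.
    by rewrite -addn1 PoszD addrA height_up.
  by rewrite -addn1 PoszD [in LHS]addrA height_right.
have hz := hl 0%N n; have hu := hl m k.
have hz' := hl' 0%N n; have hu' := hl' m' k'.
rewrite addr0 subrK in hz; rewrite addr0 subrK in hz'.
move: tmk tmk'; rewrite /touching /reflect_labels /= !lE !l'E /=.
(* The upper right corner is reached along the bottom and right edges, in the reflected case along
   the left and top edges; it lies two above the lower left corner. *)
case/and4P=> t1 _ t2 _; case/and4P=> t1' _ t2' _.
apply: sub_finite_set (finite_box (x - n%:Z + k'%:Z) (x + m%:Z)
  (y - n%:Z + k%:Z) (y + m'%:Z)).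
apply: (@zero_cluster_pinched w wC (x, y) (x + m%:Z, y - n%:Z + k%:Z)
  (x - n%:Z + k'%:Z, y + m'%:Z)).
- split=> /=; first by move: hz hu hmk; lia.
  rewrite height_up height_right //.
  by move: t1 t2; rewrite -addn1 PoszD addrA => -> ->; move: hz hu hmk; lia.
- split=> /=; first by move: hz' hu' hmk'; lia.
  rewrite height_right // height_up.
  by move: t1' t2'; rewrite -addn1 PoszD addrA => -> ->; move: hz' hu' hmk'; lia.
all: rewrite /=; lia.
Qed.

(** * Passing to the measure on the plane *)

Definition flip_index (e : choice_index) : choice_index :=
  match e with
  | inl (inl i) => on_yaxis i
  | inl (inr j) => on_xaxis j
  | inr (i, j) => on_square j i
  end.

Lemma flip_indexK : involutive flip_index.
Proof. by move=> [[i|j]|[i j]]. Qed.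

Lemma label_square_swap (l b c : bool) :
  label_square b l c = ((label_square l b c).2, (label_square l b c).1).
Proof. by case: l b c => [] [] []. Qed.

(** The rule for one square is symmetric under exchange of left with bottom and right with top, so
    the whole procedure commutes with the reflection. *)
Lemma labels_of_flip (o : config) :
  labels_of (o \o flip_index) = reflect_labels (labels_of o).
Proof.
suff H j : (forall i, hlabel (o \o flip_index) i j = vlabel o j i) /\
    (forall i, vlabel (o \o flip_index) i j = hlabel o j i).
  by apply/funext => -[[i j] [|]]; have [Hh Hv] := H j; [exact: Hv|exact: Hh].
have vstep k : (forall i, hlabel (o \o flip_index) i k = vlabel o k i) ->
    forall i, vlabel (o \o flip_index) i k = hlabel o k i.
  move=> Hk; elim=> [|i IHi]; first by [].
  by rewrite vlabelS hlabelS Hk IHi label_square_swap.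
elim: j => [|j [IHh IHv]]; first by split=> //; apply: vstep.
have Hh i : hlabel (o \o flip_index) i j.+1 = vlabel o j.+1 i.
  by rewrite hlabelS vlabelS IHh IHv label_square_swap.
by split=> //; exact: vstep.
Qed.

(** * Measurability of the touching event *)

Section TouchMeasurable.
Context d (T : measurableType d).

Definition measurable_nat (g : T -> nat) := forall v, measurable [set t | g t = v].

Lemma measurable_nat_rel (r : nat -> nat -> Prop) (g h : T -> nat) :
  measurable_nat g -> measurable_nat h -> measurable [set t | r (g t) (h t)].
Proof.
move=> mg mh.
rewrite (_ : [set t | _] = \bigcup_u \bigcup_(v in [set v | r u v])
    ([set t | g t = u] `&` [set t | h t = v])); last first.
  apply/seteqP; split=> t /=; last by move=> [u _ [v /= ruv [-> ->]]].
  by move=> rt; exists (g t) => //; exists (h t).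
by apply: bigcup_measurable => u _; apply: bigcup_measurable => v _; exact: measurableI.
Qed.

Lemma measurable_nat_bool (f : T -> bool) :
  measurable [set t | f t] -> measurable_nat f.
Proof.
move=> mf [|[|v]].
- rewrite (_ : [set t | _] = [set t | ~~ f t]); first exact: measurable_predC.
  by apply: eq_set => t; case: (f t); apply/propext; split.
- by rewrite (_ : [set t | _] = [set t | f t]) //; apply: eq_set => t;
    case: (f t); apply/propext; split.
- rewrite (_ : [set t | _] = set0) //.
  by apply/seteqP; split=> t //=; case: (f t).
Qed.

Lemma measurable_nat_sum (f : nat -> T -> bool) n :
  (forall k, measurable [set t | f k t]) ->
  measurable_nat (fun t => \sum_(0 <= k < n) f k t)%N.
Proof.
move=> mf; elim: n => [|n IHn] v.
  rewrite (_ : [set t | _] = [set t | 0%N = v]); last first.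
    by apply: eq_set => t; rewrite big_geq.
  exact: (measurable_nat_rel (fun _ _ => 0%N = v) (measurable_nat_bool (mf 0%N))
    (measurable_nat_bool (mf 0%N))).
rewrite (_ : [set t | _] =
    [set t | ((\sum_(0 <= k < n) f k t) + f n t)%N = v]); last first.
  by apply: eq_set => t; rewrite big_nat_recr.
exact: (measurable_nat_rel (fun x y => (x + y)%N = v) IHn (measurable_nat_bool (mf n))).
Qed.

Lemma measurable_qheight (L : T -> labelling quadrant_edge) i j :
  (forall e, measurable [set t | L t e]) ->
  measurable_nat (fun t => qheight (L t) i j).
Proof.
move=> mL v; rewrite /qheight.
exact: (measurable_nat_rel (fun x y => (x + y)%N = v)
  (measurable_nat_sum (f := fun k t => L t ((k, 0%N), horizontal)) _ (fun=> mL _))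
  (measurable_nat_sum (f := fun k t => L t ((i, k), vertical)) _ (fun=> mL _))).
Qed.

Lemma measurable_touch_below (L : T -> labelling quadrant_edge) n :
  (forall e, measurable [set t | L t e]) ->
  measurable [set t | touch_below n (L t)].
Proof.
move=> mL.
rewrite (_ : [set t | _] = \bigcup_m \bigcup_(k in [set k | (k < n)%N])
    ([set t | touching (L t) m k] `&`
     [set t | (qheight (L t) m k).+1 = qheight (L t) 0 n])); last first.
  apply/seteqP; split=> t /=.
    by move=> [m [k [kn tmk hmk]]]; exists m => //; exists k.
  by move=> [m _ [k /= kn [tmk hmk]]]; exists m, k.
apply: bigcup_measurable => m _; apply: bigcup_measurable => k _.
apply: measurableI; first by do 3!apply: measurable_predI => //; exact: mL.
exact: (measurable_nat_rel (fun x y => x.+1 = y)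
  (measurable_qheight _ _ mL) (measurable_qheight _ _ mL)).
Qed.

End TouchMeasurable.

Lemma measurable_label (E : Type) (e : E) :
  measurable [set w : labelling E | w e].
Proof.
apply: sub_sigma_algebra; exists e, true; exact: eq_set.
Qed.

(** * The law of the random choices and its reflection *)

Section Choices.
Context (R : realType) d (T : measurableType d) (P : probability T R).

Lemma procedure_choices_flip (p : R) (X : choice_index -> {RV P >-> bool}) :
  procedure_choices p X -> procedure_choices (1 - p) (X \o flip_index).
Proof.
move=> [Xind Xx Xy Xq]; split=> [|i|j|i j]; last 3 first.
- exact: Xy.
- by rewrite subKr; exact: Xx.
- exact: Xq.
move=> s B us mB.
have -> : \bigcap_(e in [set` s]) (X \o flip_index) e @^-1` B e =
    \bigcap_(e in [set` map flip_index s]) X e @^-1` B (flip_index e).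
  apply/seteqP; split=> t H e /=.
    by move=> /mapP[e' e's ->]; rewrite flip_indexK; exact: H.
  by move=> es; have := H (flip_index e); rewrite /= flip_indexK; apply; exact: map_f.
rewrite (Xind _ (B \o flip_index)) ?map_inj_uniq //; last exact: inv_inj flip_indexK.
by rewrite big_map; apply: eq_bigr => e _; rewrite /= flip_indexK.
Qed.

Lemma has_law_choices (p : R) (X : choice_index -> {RV P >-> bool}) :
  procedure_choices p X -> has_law p P predT (fun t e => X e t) setT.
Proof.
move=> [Xind Xx Xy Xq] s us _ c.
have mX e b : measurable (X e @^-1` [set b]).
  by apply: measurable_funPTI.
have PX e b : P (X e @^-1` [set b]) = (weight p e b)%:E.
  have PT : P (X e @^-1` [set true]) = (weight p e true)%:E.
    by case: e => [[i|j]|[i j]]; [exact: Xx|exact: Xy|exact: Xq].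
  case: b => //.
  rewrite (_ : _ @^-1` _ = ~` (X e @^-1` [set true])); last first.
    by apply/seteqP; split=> t /=; case: (X e t).
  by rewrite probability_setC // PT /weight -EFinB.
rewrite setTI /pr probability_setT mul1r.
have -> : agrees s (fun t e => X e t) c =
    \bigcap_(e in [set` s]) X e @^-1` [set c e].
  apply/seteqP; split=> t; rewrite /agrees /=.
    by move=> /allP H e /= es; apply/eqP; exact: H.
  by move=> H; apply/allP => e es; apply/eqP; exact: H.
rewrite (Xind s (fun e => [set c e])) //.
rewrite (eq_bigr (fun e => (weight p e (c e))%:E)) ?prodEFin // => e _; exact: PX.
Qed.

Lemma observable_choices (X : choice_index -> {RV P >-> bool}) :
  observable (fun t e => X e t).
Proof.
move=> e; rewrite (_ : [set t | _] = X e @^-1` [set true]) //.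
exact: measurable_funPTI.
Qed.

Lemma procedure_flip (X : choice_index -> {RV P >-> bool}) t :
  procedure (X \o flip_index) t = reflect_labels (procedure X t).
Proof. exact: (labels_of_flip (fun e => X e t)). Qed.

Lemma not_touch_below_procedure_le (p : R) (X : choice_index -> {RV P >-> bool}) n :
  0 <= p -> p <= 1 -> procedure_choices p X ->
  (P [set t | ~ touch_below n (procedure X t)] <=
   (rate (1 - p) ^+ n + rate p ^+ n)%:E)%E.
Proof.
move=> p0 p1 /has_law_choices law.
have mX := observable_choices X.
have mt : measurable [set t | touch_below n (procedure X t)].
  apply: measurable_touch_below => -[[i j] [|]].
    exact: (observable_labels i j mX).2.
  exact: (observable_labels i j mX).1.
rewrite -(fineK (fin_num_measure P _ (measurableC mt))) lee_fin.
(* The number of columns is chosen equal to the number of rows. *)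
exact: not_touch_below_le law mt.
Qed.

End Choices.

Lemma negligible_bigcup_countable d (T : measurableType d) (R : realType)
    (mu : {measure set T -> \bar R}) (I : countType) (A : I -> set T) :
  (forall i, mu.-negligible (A i)) -> mu.-negligible (\bigcup_i A i).
Proof.
move=> nA.
apply: (@negligibleS _ _ _ _ (\bigcup_n (if unpickle n is Some i then A i else set0))).
  by move=> t [i _ Ait]; exists (pickle i); rewrite ?pickleK.
apply: negligible_bigcup => n; case: (unpickle n) => [i|]; first exact: nA.
exact: negligible_set0.
Qed.

(** * Null sets of the measure on the plane *)

Section Conclusion.
Context (R : realType) (p : R) (p_gt0 : 0 < p) (p_lt1 : p < 1).
Context d (T : measurableType d) (P : probability T R).
Variables (X : choice_index -> {RV P >-> bool}) (X_choices : procedure_choices p X).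
Variables (mu : probability (labelling edge) R).
Hypotheses (mu_inv : translation_invariant mu) (mu_ext : extends_procedure X mu).

Lemma measurable_quadrant_label (v : vertex) (e : quadrant_edge) :
  measurable [set w | quadrant_at v w e].
Proof. exact: measurable_label. Qed.

(** Translation invariance carries the quadrant at [v] to the first quadrant, whose marginal is
    given. *)
Lemma quadrant_law (v : vertex) (A : set (labelling quadrant_edge)) :
  measurable A -> measurable [set w | A (restrict_quadrant w)] ->
  mu [set w | A (quadrant_at v w)] = P [set t | A (procedure X t)].
Proof. by move=> mA mrA; rewrite -(mu_ext mA) -(mu_inv v mrA). Qed.

Lemma measurable_unpinched n z : measurable [set w | unpinched n z w].
Proof.
have mv := measurable_quadrant_label.
by apply: measurableU; apply: measurableC; apply: measurable_touch_below => e; exact: mv.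
Qed.

Lemma unpinched_le n z :
  (mu [set w | unpinched n z w] <= ((rate (1 - p) ^+ n + rate p ^+ n) *+ 2)%:E)%E.
Proof.
have mv := measurable_quadrant_label.
have mr (e : quadrant_edge) : measurable [set w | restrict_quadrant w e].
  exact: measurable_label.
have ml (e : quadrant_edge) : measurable [set l : labelling quadrant_edge | l e].
  exact: measurable_label.
have [p0 p1] : 0 <= p /\ p <= 1 by rewrite !ltW.
pose A := [set w | ~ touch_below n (quadrant_at (z - (0, n%:Z)) w)].
pose B := [set w | ~ touch_below n (reflect_labels (quadrant_at (z - (n%:Z, 0)) w))].
apply: (@le_trans _ _ (mu A + mu B)%E).
  apply: measureU2; apply: measurableC; apply: measurable_touch_below => e; exact: mv.
rewrite mulr2n EFinD; apply: leeD.
  rewrite (quadrant_law _ (A := [set l | ~ touch_below n l])).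
  - exact: not_touch_below_procedure_le.
  - by apply: measurableC; apply: measurable_touch_below => e; exact: ml.
  - by apply: measurableC; apply: measurable_touch_below => e; exact: mr.
rewrite (quadrant_law _ (A := [set l | ~ touch_below n (reflect_labels l)])).
- rewrite (_ : [set t | _] =
    [set t | ~ touch_below n (procedure (X \o flip_index) t)]); last first.
  by apply: eq_set => t; rewrite procedure_flip.
  (* The reflected procedure has parameter 1 - p, which exchanges the two rates. *)
  rewrite addrC -{1}[p](subKr 1).
  apply: not_touch_below_procedure_le; last exact: procedure_choices_flip.
    by rewrite subr_ge0.
  by rewrite gerBl.
- by apply: measurableC; apply: measurable_touch_below => e; exact: ml.
- by apply: measurableC; apply: measurable_touch_below => e; exact: mr.
Qed.

(** The intersection is at most as likely as each of its members, and their bounds tend to 0 because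
    0 < p < 1 makes both rates smaller than 1. *)
Lemma negligible_unpinched z : mu.-negligible (\bigcap_n [set w | unpinched n z w]).
Proof.
have mU : measurable (\bigcap_n [set w | unpinched n z w]).
  by apply: bigcapT_measurable => n; exact: measurable_unpinched.
apply/(negligibleP _ mU)/eqP; rewrite -measure_le0.
rewrite -(fineK (fin_num_measure mu _ mU)) lee_fin.
have rate_lt1 (q : R) : 0 < q -> q < 1 -> `|rate q| < 1.
  by move=> q0 q1; rewrite ger0_norm ?rate_ge0 ?ltW // /rate ltrBlDr ltrDl divr_gt0.
have cv : (fun n => (rate (1 - p) ^+ n + rate p ^+ n) *+ 2 : R) @ \oo --> (0 : R).
  rewrite -(mul0rn R 2) -(addr0 (0 : R)); apply: cvgMn; apply: cvgD; apply: cvg_expr.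
    by apply: rate_lt1; rewrite ?subr_gt0 // gtrBl.
  exact: rate_lt1.
rewrite -(cvg_lim _ cv) //; apply: limr_ge; first by apply/cvg_ex; exists 0.
apply: nearW => n; rewrite -lee_fin fineK ?fin_num_measure //.
apply: le_trans (unpinched_le n z); apply: le_measure; rewrite ?inE //.
  exact: measurable_unpinched.
exact: bigcap_inf.
Qed.

(** A violation at [v] is a violation in the corner square of the quadrant at [v], which the
    procedure never produces; there are countably many [v]. *)
Lemma negligible_not_cocycle : mu.-negligible [set w | ~ cocycle w].
Proof.
pose bad := [set l : labelling quadrant_edge |
  (l ((0, 0), horizontal) + l ((1, 0), vertical) !=
   l ((0, 0), vertical) + l ((0, 1), horizontal))%N].
have mbad d' (S : measurableType d') (L : S -> labelling quadrant_edge) :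
    (forall e, measurable [set s | L s e]) -> measurable [set s | bad (L s)].
  move=> mL; rewrite /bad.
  pose A (s : S) := (L s ((0, 0), horizontal) + L s ((1, 0), vertical))%N.
  pose B (s : S) := (L s ((0, 0), vertical) + L s ((0, 1), horizontal))%N.
  have mA : measurable_nat A.
    move=> v; exact: (measurable_nat_rel (fun x y => (x + y)%N = v)
      (measurable_nat_bool (mL _)) (measurable_nat_bool (mL _))).
  have mB : measurable_nat B.
    move=> v; exact: (measurable_nat_rel (fun x y => (x + y)%N = v)
      (measurable_nat_bool (mL _)) (measurable_nat_bool (mL _))).
  exact: (measurable_nat_rel (fun x y => x != y) mA mB).
apply: (@negligibleS _ _ _ _ (\bigcup_v [set w | bad (quadrant_at v w)])).
  move=> w; apply: contra_notP => nb x y.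
  apply/eqP; apply: contrapT => /negP wxy; apply: nb; exists (x, y) => //=.
  by rewrite /bad /= !quadrant_atE /= !addr0.
apply: negligible_bigcup_countable => v.
apply/negligibleP; first by apply: mbad => e; exact: measurable_quadrant_label.
apply: eq_trans (quadrant_law v (A := bad) _ _) _; last first.
- rewrite (_ : [set t | _] = set0) ?measure0 //; apply/seteqP; split=> t //=.
  by have := label_cocycle (fun e => X e t) 0 0; rewrite /bad /= => /eqP ->.
- exact: (mbad _ (labelling edge) restrict_quadrant (fun e => measurable_label _)).
- exact: (mbad _ (labelling quadrant_edge) (fun l => l) (@measurable_label _)).
Qed.

End Conclusion.

Theorem theorem4p2 (R : realType) (p : R) (p_gt0 : 0 < p) (p_lt1 : p < 1)
    (d : measure_display) (T : measurableType d) (P : probability T R)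
    (X : choice_index -> {RV P >-> bool}) (X_choices : procedure_choices p X)
    (mu : probability (labelling edge) R) (mu_inv : translation_invariant mu)
    (mu_ext : extends_procedure X mu) :
  {ae mu, forall w, ~ percolates w}.
Proof.
apply: (@negligibleS _ _ _ _ ([set w | ~ cocycle w] `|`
    \bigcup_z \bigcap_n [set w | unpinched n z w])); last first.
  apply: negligibleU; first exact: (negligible_not_cocycle mu_inv mu_ext).
  apply: negligible_bigcup_countable => z.
  exact: (negligible_unpinched p_gt0 p_lt1 X_choices mu_inv mu_ext).
move=> w /= /contrapT[z infz].
have [wC|] := pselect (cocycle w); last by left.
right; exists z => // n _ /=; apply: contrapT => nu.
exact/infz/(finite_cluster wC nu).
Qed.
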